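(* Let $p$ be a prime number and assume $D=p^e$ is a prime power ($e\geq 1$). Then $R_{k,1,d}$ is irreducible over $\mathbb{Q}$ for all $k\geq 2$ and for all $d\geq 2$ that divide $D$. More generally, if $n\geq 2$ and the polynomial $R_n \bmod p$ is irreducible over $\mathbb{F}_p$, then $R_{k,n,d}$ is irreducible over $\mathbb{Q}$ for all $k\geq 2$ and for all $d\geq 2$ that divide $D$.
   Context: Let $D\geq 2$ be an integer and, for $a\in\mathbb{C}$, let $f_a(z)=az^D+1$, with critical point $0$. A point $z$ is periodic for $f_a$ with period $n\geq 1$ if $f_a^{\circ n}(z)=z$ and $n$ is the least such integer; it is preperiodic with preperiod $k\geq 0$ and period $n$ if $k$ is the least nonnegative integer such that $f_a^{\circ k}(z)$ is periodic, and $f_a^{\circ k}(z)$ has period $n$. For $n\geq 1$, $P_n\in\mathbb{Z}[a]$ is defined by $P_n(a)=f_a^{\circ n}(0)$, i.e. $P_1=1$ and $P_{n+1}=aP_n^D+1$. With $\mu$ the Möbius function, $R_n:=\prod_{m\mid n}P_m^{\mu(n/m)}$, which is a polynomial in $\mathbb{Z}[a]$, and $P_n=\prod_{m\mid n}R_m$. For $k\geq 2$, $n\geq 1$ and $d\geq 2$ dividing $D$, $R_{k,n,d}$ is the monic polynomial with simple roots whose roots are the parameters $a\in\mathbb{C}$ such that $0$ is preperiodic for $f_a$ with preperiod $k$ and period $n$, and $f_a^{\circ(k+n-1)}(0)=\omega f_a^{\circ(k-1)}(0)$ for some primitive $d$-th root of unity $\omega$. It belongs to $\mathbb{Z}[a]$;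 equivalently, $R_{k,n,d}=\prod_{m\mid n}\left(P_{k,m,d}/P_{\gcd(m,k-1)}^{\varphi(d)}\right)^{\mu(n/m)}$, where $P_{k,m,d}:=\prod_{\omega}(P_{k+m-1}-\omega P_{k-1})$ (product over primitive $d$-th roots of unity) and $\varphi$ is the Euler totient function. *)

(* Defs.v *)
(* The complex numbers are R[i] for an arbitrary R : realType. *)
From mathcomp Require Import all_boot all_order all_algebra.
From mathcomp Require Import all_field.
From mathcomp Require Import boolp classical_sets reals.
From mathcomp Require Import complex.

Set Implicit Arguments.
Unset Strict Implicit.
Unset Printing Implicit Defensive.
Import GRing.Theory.
Local Open Scope ring_scope.

Section Dynamics.
Variables (T : Type) (g : T -> T).

Definition has_period (n : nat) (z : T) : Prop :=
  [/\ (0 < n)%N, iter n g z = z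
    & forall m : nat, (0 < m < n)%N -> iter m g z <> z].

Definition periodic (z : T) : Prop := exists n : nat, has_period n z.

Definition preperiodic (k n : nat) (z : T) : Prop :=
  has_period n (iter k g z)
  /\ forall j : nat, (j < k)%N -> ~ periodic (iter j g z).

End Dynamics.

Definition unicritical (A : nzRingType) (D : nat) (a z : A) : A :=
  a * z ^+ D + 1.

(* The parameter a is the indeterminate, so P D 0 = 0, P D 1 = 1 (for D > 0)
   and P D n.+1 = 'X * P D n ^+ D + 1. *)
Definition P (D n : nat) : {poly int} := iter n (unicritical D 'X) 0.

Definition moebius (n : nat) : int :=
  if all (fun q => logn q n == 1%N) (primes n) then (-1) ^+ size (primes n)
  else 0.

(* The product is taken in the field of fractions of Z[a]; Rper D n is the
   element of Z[a] equal to it (unique by Rper_unique below). *)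
Definition is_Rper (D n : nat) (Q : {poly int}) : Prop :=
  tofrac Q =
  \prod_(m <- divisors n) tofrac (P D m) ^ moebius (n %/ m)%N.

Definition Rper (D n : nat) : {poly int} := xget 0 [set Q | is_Rper D n Q].

Definition misiurewicz (C : fieldType) (D k n d : nat) (a : C) : Prop :=
  let f := unicritical D a in
  preperiodic f k n 0
  /\ exists2 w : C, d.-primitive_root w &
       iter (k + n - 1)%N f 0 = w * iter (k - 1)%N f 0.

Definition is_Rpre (C : fieldType) (D k n d : nat) (Q : {poly int}) : Prop :=
  let QC : {poly C} := map_poly intr Q in
  [/\ Q \is monic,
      forall a : C, root QC a <-> misiurewicz D k n d a
    & forall a : C, root QC a -> mup a QC = 1%N].

(* The value 0 taken when no such polynomial exists is not irreducible. *)
Definition Rpre (C : fieldType) (D k n d : nat) : {poly int} :=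
  xget 0 [set Q | is_Rpre C D k n d Q].

Lemma Rper_unique (D n : nat) (Q1 Q2 : {poly int}) :
  is_Rper D n Q1 -> is_Rper D n Q2 -> Q1 = Q2.
Proof.
by rewrite /is_Rper => <- /eqP; rewrite tofrac_eq => /eqP.
Qed.

Lemma Rpre_unique (C : numClosedFieldType) (D k n d : nat)
    (Q1 Q2 : {poly int}) :
  is_Rpre C D k n d Q1 -> is_Rpre C D k n d Q2 -> Q1 = Q2.
Proof.
move=> [m1 r1 s1] [m2 r2 s2].
apply: (@map_inj_poly _ _ (intr : int -> C)) => //; first exact: intr_inj.
set q1 := map_poly _ Q1; set q2 := map_poly _ Q2.
have M1 : q1 \is monic by apply: monic_map.
have M2 : q2 \is monic by apply: monic_map.
have mupE a : mup a q1 = mup a q2.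
  case: (boolP (root q1 a)) => h1.
    by rewrite (s1 _ h1) s2 //; apply/r2/r1.
  rewrite !mupNroot //; apply/negP => /r2/r1 h; exact: (negP h1).
have [t1 e1] := closed_field_poly_normal q1.
have [t2 e2] := closed_field_poly_normal q2.
move: mupE; rewrite e1 e2 (monicP M1) (monicP M2) !scale1r => mupE.
apply: perm_big; apply/allP => x _ /=.
by rewrite -!mu_prod_XsubC mupE.
Qed.

(* Main.v *)
Require Import Defs.
From mathcomp Require Import all_boot all_order all_algebra.
From mathcomp Require Import qpoly ring zify.
From mathcomp Require Import boolp classical_sets.
From mathcomp Require Import reals complex.

(** Write [f z = a * z ^+ D + 1] with [D = p ^ e], [d = p ^ j.+1] and
[q = p ^ j], and let [Phi x y] be the sum over [i < p] of
[x ^+ (q * (p.-1 - i)) * y ^+ (q * i)]: the homogenization of the [d]-th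
cyclotomic polynomial, of degree [s = q * p.-1].  With [k.+1] as preperiod, the
parameters of the theorem are roots of [G = Phi (P (n + k)) (P k)].  They are
the roots of [G] that are not roots of [P k] and for which the periodic part of
the critical orbit has no period smaller than [n] (lemma [misiurewiczP]).

Modulo [p] the Frobenius gives [f^m z - f^m w = a^N (z - w)^(D^m)] for some
[N >= m], and [Phi x y = (x - y)^s], so [G] becomes
[(a^N P_n^(D^k))^s].  Let [r] be the polynomial [a] if [n = 1], and the
reduction of [R_n] if [n >= 2]; it is irreducible.  The proof compares the monic
irreducible factors of [G] over the integers with [r].

The first point is that every monic irreducible [F] with a root among these
parameters is divisible by [r] modulo [p].  Since [f] has zero derivative in
characteristic [p], two distinct periodic points never collide modulo [p]:
if [F] divides [P (n + l) - P l] but not [P (m + l) - P l], where [l = k.+1],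
then [F] is prime to the latter modulo [p] (lemma [coprimep_redp_P]).  Hence,
modulo [p], [F] is prime to [a P_m] for every proper divisor [m] of [n], and as
it divides a power of [a P_n], only the factor [r] is left.

The second point is that no product [A * B] with [A] and [B] both divisible by
[r] modulo [p] divides [G], once the common factor of [P (n + k)] and [P k] is
removed from both.  Let [E] be [a] if [n = 1], and [P_n] if [n >= 2]; modulo [p]
it is divisible by [r] but not by [r^2].  As in the criterion of Eisenstein, such
a product vanishes modulo [p^2] at a root of [E] reducing to a root of [r],
whereas [Phi x y] is there equal to [Phi y y = p y^s], with [y] nonzero modulo
[p] (lemma [eisenstein_factor]).

As [r] does divide [G] modulo [p], there is a monic irreducible factor [F] of
[G] divisible by [r] modulo [p].  Its roots are parameters of the theorem, and
by the two points a monic irreducible polynomial having any such parameter as a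
root is equal to [F].  So [F] is the polynomial [Rpre], which proves at once
that the latter exists and that it is irreducible (lemma [Rpre_irreducible]).

For [n >= 2] it remains to see that [r], the reduction of [R_n], divides [P_m]
modulo [p] exactly when [n] divides [m].  The indices [m] with this
property are the multiples of some [t].  All the [P_m], [m >= 1], are squarefree
modulo [p], so the multiplicity of [r] in the product defining [R_n] is the sum
of [mu (n / m)] over the multiples [m] of [t] dividing [n], which is [1] if
[t = n] and [0] otherwise; but that product is [r] modulo [p] (lemma
[dvd_redp_P_Rper]). *)

Set Implicit Arguments.
Unset Strict Implicit.
Unset Printing Implicit Defensive.
Import Order.TTheory GRing.Theory Num.Theory.
Local Open Scope ring_scope.

(** * Irreducible polynomials over the integers *)

Lemma irreducible_dvdM (A : idomainType) (r f g : {poly A}) :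
  irreducible_poly r -> (r %| f * g) = (r %| f) || (r %| g).
Proof.
move=> ir; apply/idP/orP => [rfg|[rf|rg]]; first last.
- exact: dvdp_mull.
- exact: dvdp_mulr.
have [rf|nrf] := boolP (r %| f); first by left.
by right; rewrite -(@Gauss_dvdpr _ _ f) // irreducible_poly_coprime.
Qed.

Lemma irreducible_dvdX (A : idomainType) (r f : {poly A}) n :
  irreducible_poly r -> r %| f ^+ n -> r %| f.
Proof.
move=> ir; elim: n => [|n IHn]; last first.
  by rewrite exprS irreducible_dvdM // => /orP[|/IHn].
by rewrite expr0 dvdp1; case: ir => r1 _ /eqP e; rewrite e in r1.
Qed.

Lemma irreducible_Ndvd1 (A : idomainType) (r : {poly A}) :
  irreducible_poly r -> ~~ (r %| 1).
Proof. by case=> r1 _; rewrite dvdp1; case: eqP r1 => // ->. Qed.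

(** Divisibility of integer polynomials is pseudo-divisibility, that is,
divisibility over the rationals, and irreducibility is irreducibility over the
rationals; monic divisors divide without denominators. *)
Lemma dvdp_int_monic (F G : {poly int}) :
  F \is monic -> F %| G -> exists H, G = F * H.
Proof.
by move=> mF /(Pdiv.IdomainMonic.dvdpP mF)[H ->]; exists H; rewrite mulrC.
Qed.

(** The property [Q] selects the factor: it will be either having a given
complex root, or being divisible by a given irreducible polynomial modulo [p].
A divisor of minimal degree satisfying [Q] is irreducible, because by the lemma
of Gauss a factorization over the rationals yields monic integral factors, one
of which inherits [Q]. *)
Lemma monic_irreducible_divisor (Q : {poly int} -> Prop) (G : {poly int}) :
    G \is monic -> ~ Q 1 ->
    (forall A B, A \is monic -> B \is monic -> Q (A * B) -> Q A \/ Q B) ->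
  Q G -> exists F, [/\ F \is monic, irreducible_poly F, F %| G & Q F].
Proof.
move=> + Q1 QM; have [n] := ubnP (size G).
elim: n G => // n IHn G sG mG QG.
have [irG|nirG] := pselect (irreducible_poly G); first by exists G; split.
have G0 : G != 0 by apply: monic_neq0.
have sG1 : (1 < size G)%N.
  rewrite ltn_neqAle size_poly_gt0 G0 andbT eq_sym; apply/eqP => sG1.
  apply: Q1; suff <- : G = 1 by [].
  have /size_poly1P[c _ Ec] : size G == 1%N by apply/eqP.
  by move: mG; rewrite Ec monicE lead_coefC => /eqP ->.
have [q [sq qG nqG]] :
    exists q : {poly int}, [/\ size q != 1%N, q %| G & ~~ (q %= G)].
  apply: contrapT => H; apply: nirG; split => // q sq qG.
  by apply/negPn/negP => nqG; apply: H; exists q.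
have [B EB] := dvdpP_int qG; set A := zprimitive q in EB.
have sA : size A = size q by rewrite size_zprimitive.
have B0 : B != 0 by apply: contraNneq G0 => B0; rewrite EB B0 mulr0.
have A0 : A != 0 by apply: contraNneq G0 => A0; rewrite EB A0 mul0r.
have ltq : (size q < size G)%N.
  rewrite ltn_neqAle dvdp_leq // andbT.
  by apply: contra nqG => ?; rewrite -dvdp_size_eqp.
have lAB : lead_coef A * lead_coef B = 1.
  by rewrite -lead_coefM -EB; apply/eqP; rewrite -monicE.
have mA : lead_coef B *: A \is monic by rewrite monicE lead_coefZ mulrC lAB.
have mB : lead_coef A *: B \is monic by rewrite monicE lead_coefZ lAB.
have EAB : G = (lead_coef B *: A) * (lead_coef A *: B).
  by rewrite -scalerAl -scalerAr scalerA mulrC lAB scale1r.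
have sAG : (size (lead_coef B *: A) < size G)%N.
  by rewrite size_scale ?lead_coef_eq0 // sA.
have sBG : (size (lead_coef A *: B) < size G)%N.
  rewrite size_scale ?lead_coef_eq0 // EB size_mul //.
  have : (1 < size A)%N.
    by rewrite sA ltn_neqAle eq_sym sq -sA size_poly_gt0.
  by case: (size A) => [|[|a]] // _; rewrite addSn /= addSn ltnS leq_addl.
have lt_n H : (size H < size G)%N -> (size H < n)%N.
  by move=> sH; apply: leq_trans sH _.
have : Q (lead_coef B *: A) \/ Q (lead_coef A *: B) by apply: QM; rewrite -?EAB.
case=> /IHn[|//|F [mF iF dF QF]]; try exact: lt_n.
  by exists F; split=> //; rewrite EAB; apply: dvdp_mulr.
by exists F; split=> //; rewrite EAB; apply: dvdp_mull.
Qed.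

(** Otherwise a Bezout relation would, at the common root, make a nonzero
integer vanish in [C]. *)
Lemma irreducible_dvdp_root (C : numFieldType) (F H : {poly int}) (a : C) :
    irreducible_poly F -> root (map_poly intr F) a ->
  root (map_poly intr H) a = (F %| H).
Proof.
move=> irF Fa; apply/idP/idP => [Ha|FH]; last first.
  have /Pdiv.Idomain.dvdpP[[c q] /= c0 E] := FH.
  have := congr1 (fun f => (map_poly (intr : int -> C) f).[a]) E.
  rewrite /= linearZ /= rmorphM /= hornerZ hornerM (rootP Fa) mulr0 => /eqP.
  by rewrite mulf_eq0 intr_eq0 (negPf c0).
apply/negPn/negP => nFH.
have /Bezout_coprimepP[[u v] /= /eqpP[[c1 c2] /andP[c10 c20] E]] : coprimep F H.
  by rewrite irreducible_poly_coprime.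
have := congr1 (fun f => (map_poly (intr : int -> C) f).[a]) E.
rewrite /= !linearZ /= rmorphD !rmorphM /= !hornerZ hornerD !hornerM.
rewrite (rootP Fa) (rootP Ha) !mulr0 addr0 mulr0 rmorph1 hornerC mulr1 => /eqP.
by rewrite eq_sym intr_eq0 (negPf c20).
Qed.

(** A multiple root would be a root of the derivative, which has smaller degree
and is nonzero in characteristic zero. *)
Lemma irreducible_simple_roots (C : numFieldType) (F : {poly int}) (a : C) :
  irreducible_poly F -> root (map_poly intr F) a -> mup a (map_poly intr F) = 1%N.
Proof.
move=> irF Fa; have F0 : map_poly (intr : int -> C) F != 0.
  rewrite map_poly_eq0_id0 ?irredp_neq0 // intr_eq0 lead_coef_eq0.
  exact: irredp_neq0.
apply/eqP; rewrite eqn_leq mup_geq // expr1 dvdp_XsubCl Fa andbT mup_leq //.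
apply/negP => /dvdpP[q E].
have : root (map_poly intr F^`()) a.
  rewrite -deriv_map /= E expr2 mulrA derivM /root hornerD !hornerM.
  by rewrite hornerXsubC subrr !(mulr0, mul0r) addr0.
rewrite (irreducible_dvdp_root _ irF Fa).
have [F'0 _|F'0 /(dvdp_leq F'0)] := eqVneq F^`() 0; last first.
  by rewrite leqNgt lt_size_deriv // irredp_neq0.
have [sF _] := irF.
have := coef_deriv F (size F).-2; rewrite F'0 coef0 prednK -?subn1 ?subn_gt0 //.
rewrite subn1 -lead_coefE => /esym/eqP; rewrite mulrn_eq0 lead_coef_eq0.
by rewrite (negPf (irredp_neq0 irF)) orbF; case: (size F) sF => [|[]].
Qed.

(** * Homogenized cyclotomic polynomials *)

(** If [q] is a power of the prime [p], this is the homogenization of the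
cyclotomic polynomial of order [p * q], so it is also the product of the
[x - w * y] over the primitive roots of unity [w] of that order. *)
Definition cyc (A : nzRingType) (p q : nat) (x y : A) : A :=
  \sum_(i < p) (x ^+ q) ^+ (p.-1 - i) * (y ^+ q) ^+ i.

Lemma cycM (A : comNzRingType) p q (x y : A) :
  (x ^+ q - y ^+ q) * cyc p q x y = x ^+ (q * p) - y ^+ (q * p).
Proof. by rewrite !exprM [RHS]subrXX. Qed.

Lemma cyc_homog (A : comNzRingType) p q (c x y : A) :
  cyc p q (c * x) (c * y) = c ^+ (q * p.-1) * cyc p q x y.
Proof.
rewrite /cyc mulr_sumr; apply: eq_bigr => i _.
rewrite !exprMn mulrACA -exprD subnK -?exprM //.
by have := ltn_ord i; lia.
Qed.

Lemma cyc_diag (A : comNzRingType) p q (y : A) :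
  cyc p q y y = p%:R * y ^+ (q * p.-1).
Proof.
rewrite /cyc (eq_bigr (fun=> y ^+ (q * p.-1))) => [|i _].
  by rewrite sumr_const card_ord mulr_natl.
rewrite -exprD subnK -?exprM //.
by have := ltn_ord i; lia.
Qed.

Lemma rmorph_cyc (A B : nzRingType) (f : {rmorphism A -> B}) p q (x y : A) :
  f (cyc p q x y) = cyc p q (f x) (f y).
Proof.
by rewrite rmorph_sum; apply: eq_bigr => i _; rewrite rmorphM !rmorphXn.
Qed.

Lemma cyc_congr (A : comNzRingType) p q (x y : A) :
  exists u, cyc p q x y = cyc p q y y + (x - y) * u.
Proof.
pose S (i : 'I_p) := \sum_(j < q * (p.-1 - i))
  x ^+ ((q * (p.-1 - i)).-1 - j) * y ^+ j.
exists (\sum_(i < p) S i * (y ^+ q) ^+ i).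
apply/eqP; rewrite addrC -subr_eq /cyc -sumrB mulr_sumr; apply/eqP.
by apply: eq_bigr => i _; rewrite -mulrBl -!exprM subrXX mulrA.
Qed.

Lemma exprB_pchar (A : comNzRingType) (p j : nat) (x y : A) :
  p \in [pchar A] -> (x - y) ^+ (p ^ j) = x ^+ (p ^ j) - y ^+ (p ^ j).
Proof.
move=> pA; have pj : [pchar A].-nat (p ^ j)%N.
  by rewrite (eq_pnat _ (pcharf_eq pA)) pnatX pnat_id ?orbT // (pcharf_prime pA).
by rewrite exprDn_pchar // exprNn_pchar.
Qed.

(** With [q = p ^ j], cancel [x ^+ q - y ^+ q = (x - y) ^+ q] in [cycM], whose
right-hand side is [(x - y) ^+ (q * p)]. *)
Lemma cyc_pchar (A : idomainType) (p j : nat) (x y : A) :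
  p \in [pchar A] -> x != y -> cyc p (p ^ j) x y = (x - y) ^+ (p ^ j * p.-1).
Proof.
move=> pA xy; have p_gt0 := prime_gt0 (pcharf_prime pA).
apply: (@mulfI _ ((x - y) ^+ (p ^ j))); first by rewrite expf_neq0 // subr_eq0.
rewrite -exprD -mulnS prednK // [in LHS]exprB_pchar // cycM -expnSr.
by rewrite exprB_pchar.
Qed.

(** * Reduction modulo p and the Eisenstein criterion *)

Local Notation redp p := (map_poly (intr : int -> 'F_p)).

Lemma redp_eq0 p (f : {poly int}) : prime p ->
  redp p f = 0 -> exists g, f = p%:R * g.
Proof.
move=> pp f0; exists (\poly_(i < size f) (f`_i %/ p)%Z).
apply/polyP => i; rewrite mulr_natl coefMn coef_poly.
case: ltnP => [_|/(nth_default 0)->]; last by rewrite mul0rn.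
have /eqP := congr1 (fun g : {poly 'F_p} => g`_i) f0.
rewrite coef_map /= coef0 => fi0.
rewrite -(dvdz_pcharf (pchar_Fp pp)) in fi0.
by rewrite -{1}(divzK fi0) -[RHS]mulr_natr natz.
Qed.

Lemma redp_surj p (g : {poly 'F_p}) : exists f, redp p f = g.
Proof.
exists (\poly_(i < size g) Posz (val (g`_i)%R)); apply/polyP => i.
rewrite coef_map coef_poly; case: ltnP => [_|/(nth_default 0)->] /=; last first.
  by rewrite mulr0z.
by rewrite -pmulrn natr_Zp.
Qed.

Lemma redp_monic_neq0 p (f : {poly int}) : f \is monic -> redp p f != 0.
Proof. by move=> mf; rewrite monic_neq0 // monic_map. Qed.

Lemma redp_dvd p (f g : {poly int}) : f \is monic -> f %| g -> redp p f %| redp p g.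
Proof.
by move=> mf /dvdp_int_monic-/(_ mf)[h ->]; rewrite rmorphM dvdp_mulr.
Qed.

(** Write the reduction of [E] as [s * r] with [r] prime to [s], and let [S]
lift [s].  If [r] divided the reductions of [A] and [B], then [S * A] and
[S * B] would lie in the ideal [(p, E)], so [S ^+ 2 * cyc p q x y] would lie in
[(p ^ 2, E)].  As [x] and [y] agree modulo [E], this element is congruent to
[p * S ^+ 2 * y ^+ (q * p.-1)] modulo [E].  Since [E] is monic one can divide by
[p], and [r] divides [s] or the reduction of [y], a contradiction. *)
Lemma eisenstein_factor p q (r : {poly 'F_p}) (E x y A B : {poly int}) :
    prime p -> irreducible_poly r ->
    E \is monic -> r %| redp p E -> ~~ (r ^+ 2 %| redp p E) ->
    E %| x - y -> ~~ (r %| redp p y) ->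
    A \is monic -> B \is monic -> A * B %| cyc p q x y ->
  ~~ (r %| redp p A) || ~~ (r %| redp p B).
Proof.
move=> pp irr mE /dvdpP[s Es] r2E Exy ry mA mB AB.
rewrite -negb_and; apply/negP => /andP[/dvdpP[a Ea] /dvdpP[b Eb]].
have rs : ~~ (r %| s).
  by apply: contra r2E => rs; rewrite Es expr2 dvdp_mul2r ?irredp_neq0.
have [S ES] := redp_surj s; have [a' Ea'] := redp_surj a.
have [b' Eb'] := redp_surj b.
have [|A1 EA1] := @redp_eq0 p (S * A - a' * E) pp.
  by rewrite rmorphB !rmorphM /= ES Ea Ea' Es mulrCA subrr.
have [|B1 EB1] := @redp_eq0 p (S * B - b' * E) pp.
  by rewrite rmorphB !rmorphM /= ES Eb Eb' Es mulrCA subrr.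
have mAB : A * B \is monic by rewrite monicMl.
have [H EH] := dvdp_int_monic mAB AB.
have [u Eu] := cyc_congr p q x y; have [v Ev] := dvdp_int_monic mE Exy.
have {EH} EW : exists W,
    p%:R * (S ^+ 2 * y ^+ (q * p.-1) - p%:R * (A1 * B1 * H)) = E * W.
  (* Expand [S ^+ 2 * cyc p q x y = (a' * E + p * A1) * (b' * E + p * B1) * H]. *)
  exists (p%:R * A1 * b' * H + a' * (p%:R * B1) * H + a' * E * b' * H
          - S ^+ 2 * v * u).
  have -> : p%:R * (S ^+ 2 * y ^+ (q * p.-1) - p%:R * (A1 * B1 * H)) =
     S ^+ 2 * (p%:R * y ^+ (q * p.-1)) - (p%:R * A1) * (p%:R * B1) * H by ring.
  move/eqP: Eu; rewrite cyc_diag -subr_eq => /eqP <-; rewrite EH -EA1 -EB1 Ev.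
  by ring.
case: EW => W EW.
have : redp p (E * W) = 0.
  by rewrite -EW rmorphM rmorph_nat -(polyC_natr 'F_p) pchar_Fp_0 // mul0r.
rewrite rmorphM => /eqP; rewrite mulf_eq0 (negPf (redp_monic_neq0 _ mE)) /=.
move=> /eqP/(redp_eq0 pp)[W' EW'].
have p0 : (p%:R : {poly int}) != 0.
  by rewrite -polyC_natr polyC_eq0 pnatr_eq0 -lt0n prime_gt0.
have {EW EW'} : S ^+ 2 * y ^+ (q * p.-1) - p%:R * (A1 * B1 * H) = E * W'.
  by apply: (mulfI p0); rewrite EW EW' mulrCA.
move/(congr1 (redp p)); rewrite rmorphB !rmorphM rmorph_nat !rmorphXn /= ES Es.
rewrite -(polyC_natr 'F_p) pchar_Fp_0 // mul0r subr0 => Esy.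
have : r %| s ^+ 2 * redp p y ^+ (q * p.-1) by rewrite Esy mulrAC dvdp_mull.
by rewrite irreducible_dvdM // => /orP[]/(irreducible_dvdX irr); apply/negP.
Qed.

(** * Critical orbits *)

Lemma rmorph_iter_unicritical (A B : nzRingType) (f : {rmorphism A -> B})
    D n (a z : A) :
  f (iter n (unicritical D a) z) = iter n (unicritical D (f a)) (f z).
Proof.
by elim: n => //= n <-; rewrite /unicritical rmorphD rmorphM rmorphXn rmorph1.
Qed.

Lemma redp_P p D n : redp p (P D n) = iter n (unicritical D 'X) 0.
Proof. by rewrite rmorph_iter_unicritical rmorph0 /= map_polyX. Qed.

Lemma horner_P (C : comNzRingType) D n (a : C) :
  (map_poly intr (P D n)).[a] = iter n (unicritical D a) 0.
Proof.
rewrite rmorph_iter_unicritical rmorph0 /= map_polyX.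
rewrite -[LHS]/(horner_eval a _) rmorph_iter_unicritical rmorph0.
by rewrite /= /horner_eval hornerX.
Qed.

Lemma P_addn D m n : P D (m + n) = iter m (unicritical D 'X) (P D n).
Proof. by rewrite /P iterD. Qed.

Lemma iter_unicritical_sub (A : comNzRingType) D n (a z w : A) :
  exists u, iter n (unicritical D a) z - iter n (unicritical D a) w = (z - w) * u.
Proof.
elim: n => [|n [u Eu]]; first by exists 1; rewrite mulr1.
rewrite !iterS; set z' := iter n _ z in Eu *; set w' := iter n _ w in Eu *.
rewrite /unicritical opprD addrACA subrr addr0 -mulrBr subrXX Eu.
by set v := \sum_(i < D) _; exists (a * u * v); ring.
Qed.

(** By the Frobenius each step raises the difference to the power [D] and brings
a factor [a].  The bound on [N] serves to divide the right-hand side by [a]. *)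
Lemma iter_unicritical_sub_pchar (A : comNzRingType) p e n (a z w : A) :
    p \in [pchar A] ->
  exists2 N, (n <= N)%N &
    iter n (unicritical (p ^ e) a) z - iter n (unicritical (p ^ e) a) w
    = a ^+ N * (z - w) ^+ ((p ^ e) ^ n).
Proof.
move=> pA; have D_gt0 : (0 < p ^ e)%N.
  by rewrite expn_gt0 prime_gt0 ?(pcharf_prime pA).
elim: n => [|n [N nN EN]]; first by exists 0; rewrite // expr0 mul1r expr1.
exists (p ^ e * N).+1; first by rewrite ltnS (leq_trans nN) ?leq_pmull.
rewrite !iterS; set z' := iter n _ z in EN *; set w' := iter n _ w in EN *.
rewrite /unicritical opprD addrACA subrr addr0 -mulrBr -exprB_pchar // EN.
by rewrite exprMn -!exprM mulrA -exprS [(N * _)%N]mulnC expnSr.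
Qed.

Lemma P_monic D n : (0 < D)%N -> (0 < n)%N -> P D n \is monic.
Proof.
move=> D0; case: n => // n _; elim: n => [|n IHn].
  by rewrite /P /= /unicritical expr0n eqn0Ngt D0 mulr0 add0r monic1.
rewrite /P iterS -/(P D n.+1) /unicritical monicE lead_coefDl.
  by rewrite -monicE monicMl ?monicX // monic_exp.
by rewrite size_poly1 mulrC size_mulX ?ltnS ?size_poly_gt0 ?expf_neq0 ?monic_neq0.
Qed.

(** Where [P D n] vanishes, the critical orbit returns to the critical
point after [n] steps. *)
Lemma P_dvd_shift D n m : P D n %| P D (m + n) - P D m.
Proof.
have [u] := iter_unicritical_sub D m 'X (P D n) 0.
by rewrite subr0 P_addn => ->; rewrite dvdp_mulr.
Qed.

(** * Misiurewicz parameters as roots of polynomials *)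

Lemma periodic_iter (T : eqType) (g : T -> T) z n :
  (0 < n)%N -> iter n g z = z ->
  exists2 t, has_period g t z & (t %| n)%N.
Proof.
move=> n0 gn; have ex : exists t, (0 < t)%N && (iter t g z == z).
  by exists n; rewrite n0 gn eqxx.
case: (ex_minnP ex) => t /andP[t0 /eqP gt] tmin; exists t.
  split=> // m /andP[m0 mt] gm.
  by have := tmin m; rewrite m0 gm eqxx leqNgt mt => /(_ isT).
have gmul c : iter (c * t) g z = z by elim: c => // c IHc; rewrite mulSn iterD IHc.
have gmod : iter (n %% t) g z = z.
  by rewrite -[in LHS](gmul (n %/ t)%N) -iterD addnC -divn_eq.
rewrite /dvdn; have := tmin (n %% t)%N; rewrite gmod eqxx andbT.
by case: (n %% t)%N (ltn_pmod n t0) => // c ct /(_ isT); rewrite leqNgt ct.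
Qed.

(** Dehomogenizing, [w = x / y] satisfies [w ^+ (p ^ j.+1) = 1], and
[w ^+ (p ^ j) = 1] is impossible as all [p] terms of the sum would then be [1].
The order of [w] is therefore exactly [p ^ j.+1]. *)
Lemma cyc_eq0P (C : numFieldType) p j (x y : C) : prime p -> y != 0 ->
  cyc p (p ^ j) x y = 0 <-> exists2 w, (p ^ j.+1).-primitive_root w & x = w * y.
Proof.
move=> pp y0; split=> [xy0|[w wd ->]]; last first.
  have wq : w ^+ (p ^ j) - 1 != 0.
    rewrite subr_eq0 -(prim_order_dvd wd) dvdn_Pexp2l ?prime_gt1 //.
    by rewrite -ltnNge.
  rewrite mulrC -[y in cyc _ _ _ y]mulr1 cyc_homog; apply/eqP.
  rewrite mulf_eq0 -[_ w 1 == 0](inj_eq (mulfI wq)) mulr0 -{1}(expr1n C (p ^ j)).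
  by rewrite cycM -expnSr (prim_expr_order wd) expr1n subrr eqxx orbT.
exists (x / y); last by rewrite divfK.
have {xy0} w0 : cyc p (p ^ j) (x / y) 1 = 0.
  move/eqP: xy0; rewrite -{1}[x](divfK y0) mulrC -[y in cyc _ _ _ y]mulr1.
  by rewrite cyc_homog mulf_eq0 expf_eq0 (negPf y0) andbF => /eqP.
set w := x / y in w0 *.
have wd : w ^+ (p ^ j.+1) = 1.
  apply/eqP; rewrite -subr_eq0 -[X in _ - X](expr1n C (p ^ j.+1)) expnSr -cycM.
  by rewrite w0 mulr0.
have [|m wm /(dvdn_pfactor _ _ pp)[i ij Em]] := prim_order_exists _ wd.
  by rewrite expn_gt0 prime_gt0.
move: ij wm; rewrite Em leq_eqVlt ltnS => /orP[/eqP -> //|ij] wm.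
have wq : w ^+ (p ^ j) = 1.
  by apply/eqP; rewrite -(prim_order_dvd wm) dvdn_exp2l.
have := w0; rewrite /cyc wq expr1n.
under eq_bigr do rewrite !expr1n mulr1.
rewrite sumr_const card_ord => /eqP; rewrite pnatr_eq0.
by rewrite eqn0Ngt prime_gt0.
Qed.

(** The preperiod is exactly [k.+1] because the points of the orbit of index
[k] and [n + k] have the same image under the map and differ by a factor
[w != 1]: were the first one periodic, they would be equal. *)
Lemma misiurewiczP (C : numFieldType) p j D k n (a : C) :
    prime p -> (p ^ j.+1 %| D)%N -> (0 < D)%N -> (0 < n)%N ->
  misiurewicz D k.+1 n (p ^ j.+1) a <->
  [/\ cyc p (p ^ j) (map_poly intr (P D (n + k))).[a] (map_poly intr (P D k)).[a]
        = 0,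
      ~~ root (map_poly intr (P D k)) a
    & forall m, (m %| n)%N -> (0 < m < n)%N ->
      ~~ root (map_poly intr (P D (m + k.+1) - P D k.+1)) a].
Proof.
move=> pp dD D0 n0; rewrite /root !horner_P.
set f := unicritical D a.
have zE m : (map_poly intr (P D (m + k.+1) - P D k.+1)).[a] =
    iter m f (iter k.+1 f 0) - iter k.+1 f 0.
  by rewrite rmorphB hornerD hornerN !horner_P iterD.
have wD (w : C) : (p ^ j.+1).-primitive_root w -> w ^+ D = 1.
  by move=> wd; apply/eqP; rewrite -(prim_order_dvd wd).
rewrite /misiurewicz -/f.
have -> : (k.+1 + n - 1 = n + k)%N by lia.
have -> : (k.+1 - 1 = k)%N by lia.
split=> [[[[_ fn nper] pre] [w wd Ew]] | [xy0 y0 nper]].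
  have y0 : iter k f 0 != 0.
    apply/eqP => y0; have := Ew; rewrite y0 mulr0 iterD y0 => x0.
    have [t tper _] := periodic_iter n0 x0.
    by apply: (pre k) => //; exists t; rewrite y0.
  split=> //; first by apply/cyc_eq0P => //; exists w.
  by move=> m _ mn; rewrite zE subr_eq0; apply/eqP/nper.
have /(cyc_eq0P _ _ pp y0)[w wd Ew] := xy0.
have fper : iter n f (iter k.+1 f 0) = iter k.+1 f 0.
  by rewrite -iterD addnS !iterS Ew /f /unicritical exprMn (wD _ wd) mul1r.
split; last by exists w.
split.
  have [t tper tn] := periodic_iter n0 fper.
  suff <- : t = n by [].
  apply/eqP; rewrite eqn_leq dvdn_leq //= leqNgt; apply/negP => ltn.
  have [t0 ft _] := tper.
  by have := nper t tn; rewrite t0 ltn zE ft subrr eqxx => /(_ isT).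
move=> i ik [t [t0 ft _]]; rewrite ltnS in ik.
have ftk : iter t f (iter k f 0) = iter k f 0.
  by rewrite -(subnK ik) iterD -iterD addnC iterD ft.
have ftm c : iter (c * t) f (iter k f 0) = iter k f 0.
  by elim: c => // c IHc; rewrite mulSn iterD IHc.
(* The point of index [n + k] is on the cycle, as an image of that of index
   [k.+1]. *)
have fnm c : iter (c * n) f (iter n f (iter k f 0)) = iter n f (iter k f 0).
  have E : iter n f (iter k f 0) = iter n.-1 f (iter k.+1 f 0).
    by rewrite [in RHS]iterS -iterSr prednK.
  elim: c => // c IHc; rewrite mulSn iterD IHc E -iterD addnC iterD.
  by rewrite fper.
have xy : iter (n + k) f 0 = iter k f 0.
  rewrite iterD -(fnm t.-1) -iterD addnC -mulSn prednK //.
  by rewrite mulnC ftm.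
have := xy0; rewrite xy cyc_diag => /eqP; rewrite mulf_eq0 pnatr_eq0 eqn0Ngt.
by rewrite prime_gt0 //= expf_eq0 (negPf y0) andbF.
Qed.

(** * Periods are preserved by reduction modulo p *)

Lemma size_P_lt D m n : (0 < D)%N -> (m < n)%N -> (size (P D m) < size (P D n))%N.
Proof.
move=> D0; have step i : (size (P D i) < size (P D i.+1))%N.
  case: i => [|i]; first by rewrite size_poly0 size_poly_gt0 monic_neq0 ?P_monic.
  have Pi0 : P D i.+1 != 0 by rewrite monic_neq0 ?P_monic.
  have lt : (size (P D i.+1) < size ('X * P D i.+1 ^+ D)%R)%N.
    by rewrite mulrC size_mulX ?expf_neq0 // ltnS dvdp_leq ?expf_neq0 ?dvdp_exp.
  rewrite -[P D i.+2]/('X * P D i.+1 ^+ D + 1).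
  by rewrite [ltnRHS]size_polyDl ?size_poly1 // (leq_ltn_trans _ lt) // size_poly_gt0.
elim: n => // n IHn; rewrite ltnS leq_eqVlt => /orP[/eqP -> //|/IHn mn].
exact: ltn_trans mn (step n).
Qed.

Lemma monic_subX (A : idomainType) (f g : {poly A}) n :
  f \is monic -> (size g < size f)%N -> (0 < n)%N -> f ^+ n - g ^+ n \is monic.
Proof.
move=> mf gf n0; rewrite monicE lead_coefDl -?monicE ?monic_exp //.
rewrite size_polyN; have f0 : f ^+ n != 0 by rewrite expf_neq0 ?monic_neq0.
have [->|g0] := eqVneq g 0; first by rewrite expr0n eqn0Ngt n0 size_poly0 size_poly_gt0.
have : ((size (g ^+ n)).-1 < (size (f ^+ n)).-1)%N.
  rewrite !size_exp ltn_pmul2r //.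
  by move: gf; rewrite -size_poly_gt0 in g0; move: g0; case: (size g); case: (size f).
by move: (size (f ^+ n)) (size (g ^+ n)) => [|b] [|a].
Qed.

Lemma cyc_monic (A : idomainType) p q (f g : {poly A}) :
    f \is monic -> (size g < size f)%N -> (0 < p)%N -> (0 < q)%N ->
  cyc p q f g \is monic.
Proof.
move=> mf gf p0 q0; have := cycM p q f g.
have mq := monic_subX mf gf q0; move=> E.
by rewrite -(monicMl _ mq) E monic_subX // muln_gt0 q0.
Qed.

Lemma redp_P_sub p e m k : prime p ->
  exists2 N, (k <= N)%N &
    redp p (P (p ^ e) (m + k) - P (p ^ e) k)
    = 'X ^+ N * redp p (P (p ^ e) m) ^+ ((p ^ e) ^ k).
Proof.
move=> pp; have pA : p \in [pchar {poly 'F_p}].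
  by rewrite pchar_poly pchar_Fp.
have [N kN EN] := iter_unicritical_sub_pchar e k 'X (redp p (P (p ^ e) m)) 0 pA.
exists N => //; rewrite rmorphB addnC P_addn rmorph_iter_unicritical.
by rewrite /= map_polyX [redp p (P _ k)]redp_P EN subr0.
Qed.

(** Let [z] and [z'] be the critical orbit points of index [k] and [m + k], and
write [f^n z' - f^n z = (z' - z) * U].  Modulo [F] both points are fixed by
[f^n], so [F] divides [(z' - z) * (U - 1)], hence [U - 1].  Modulo [p], on the
other hand, [U] is ['X^N * (z' - z) ^+ (D ^ n - 1)], a multiple of [z' - z].  So
[F] and [z' - z] are coprime modulo [p], and [z' - z] is there the product of
positive powers of ['X] and of [P D m]. *)
Lemma coprimep_redp_P p e k m n (F : {poly int}) :
    prime p -> (0 < e)%N -> (0 < k)%N -> (0 < m)%N -> (0 < n)%N ->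
    F \is monic -> irreducible_poly F -> F %| P (p ^ e) (n + k) - P (p ^ e) k ->
    ~~ (F %| P (p ^ e) (m + k) - P (p ^ e) k) ->
  coprimep (redp p F) ('X * redp p (P (p ^ e) m)).
Proof.
move=> pp e0 k0 m0 n0 mF iF Fn Fm; set D := (p ^ e)%N in Fn Fm *.
have D1 : (1 < D)%N by rewrite -{1}(expn0 p) ltn_exp2l ?prime_gt1.
(* Exchanging the roles of [m] and [n] gives the same left-hand side as
   [(z' - z) * (U - 1)], visibly divisible by [F]. *)
have [U EU] := iter_unicritical_sub D n 'X (P D (m + k)) (P D k).
have [V EV] := iter_unicritical_sub D m 'X (P D (n + k)) (P D k).
have {Fn EV} Fnm : F %| (P D (m + k) - P D k) * (U - 1).
  suff -> : (P D (m + k) - P D k) * (U - 1) = (P D (n + k) - P D k) * (V - 1).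
    by rewrite dvdp_mulr.
  rewrite !mulrBr !mulr1 -EU -EV -!P_addn addnCA.
  by ring.
move: Fnm; rewrite irreducible_dvdM // (negPf Fm) => /(dvdp_int_monic mF)[W EW].
set d := redp p (P D (m + k) - P D k).
have [N kN EN] := redp_P_sub e m k pp; rewrite -/D -/d in EN.
have d0 : d != 0.
  by rewrite EN mulf_neq0 ?expf_neq0 ?polyX_eq0 // redp_monic_neq0 ?P_monic // ltnW.
have pA : p \in [pchar {poly 'F_p}] by rewrite pchar_poly pchar_Fp.
have [M _ EM] := iter_unicritical_sub_pchar e n 'X (redp p (P D (m + k)))
  (redp p (P D k)) pA; rewrite -/D in EM.
have dU : d %| redp p U.
  rewrite -(dvdp_mul2l _ _ d0); move/(congr1 (redp p)): EU.
  rewrite rmorphM rmorphB !(rmorph_iter_unicritical _ D n) /= map_polyX EM.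
  rewrite -rmorphB -/d => <-; rewrite dvdp_mull // -expr2 dvdp_exp2l //.
  by rewrite (leq_trans D1) // -{1}(expn1 D) leq_pexp2l // ltnW.
have cFd : coprimep (redp p F) d.
  have /dvdpP[T ET] := dU; apply/Bezout_eq1_coprimepP.
  exists (- redp p W, T); rewrite /= -ET mulNr mulrC -rmorphM -EW.
  by rewrite rmorphB rmorph1 opprB subrK.
apply: coprimep_dvdl cFd; rewrite EN dvdp_mul // dvdp_exp //.
  exact: leq_trans k0 kN.
by rewrite expn_gt0 (ltnW D1).
Qed.

(** * Irreducibility from one irreducible factor modulo p *)

Lemma horner_map_cyc (C : comNzRingType) p q (f g : {poly int}) (a : C) :
  cyc p q (map_poly intr f).[a] (map_poly intr g).[a]
  = (map_poly intr (cyc p q f g)).[a].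
Proof. by rewrite rmorph_cyc -[RHS]/(horner_eval a _) rmorph_cyc. Qed.

(** Some monic irreducible factor [F] of [cyc p (p ^ j) x y] is divisible by [r]
modulo [p], and its roots are Misiurewicz parameters.  Conversely the monic
irreducible polynomial of such a parameter is divisible by [r] modulo [p], so by
[eisenstein_factor] it cannot be a factor besides [F].  Hence [F] is [Rpre].

The polynomial [c] is the common factor to be removed from [P D (n + k)] and
[P D k]: it is [P D n] if [1 < n] and [n] divides [k], and [1] otherwise.  The
polynomial ['X] is excluded as a factor only along with the [P D m] for [m] a
proper divisor of [n]: there is none for [n = 1], where [r] is ['X]. *)
Lemma Rpre_irreducible (C : numClosedFieldType) p e j D k n
    (r : {poly 'F_p}) (E c x y : {poly int}) :
    prime p -> (0 < e)%N -> D = (p ^ e)%N -> (p ^ j.+1 %| D)%N ->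
    (0 < k)%N -> (0 < n)%N ->
    irreducible_poly r ->
    (forall m, (m %| n)%N -> (0 < m < n)%N -> ~~ (r %| 'X * redp p (P D m))) ->
    (forall N M (F : {poly 'F_p}), size F != 1%N ->
       F %| 'X ^+ N * redp p (P D n) ^+ M ->
       (forall m, (m %| n)%N -> (0 < m < n)%N ->
          coprimep F ('X * redp p (P D m))) ->
       r %| F) ->
    E \is monic -> r %| redp p E -> ~~ (r ^+ 2 %| redp p E) ->
    c \is monic -> P D (n + k) = c * x -> P D k = c * y ->
    E %| x - y -> ~~ (r %| redp p y) ->
    (forall F, F \is monic -> F %| c -> F %| cyc p (p ^ j) x y -> F = 1) ->
  irreducible_poly
    (map_poly (intr : int -> rat) (Rpre C D k.+1 n (p ^ j.+1))).
Proof.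
move=> pp e0 DE dD k0 n0 irr rm rfac mE rE r2E mc Ex Ey Exy ry cPhi.
have p0 := prime_gt0 pp.
have q0 : (0 < p ^ j)%N by rewrite expn_gt0 p0.
have D0 : (0 < D)%N by rewrite DE expn_gt0 p0.
set q := (p ^ j)%N in q0 cPhi; set Phi := cyc p q x y in cPhi.
have EPhi : cyc p q (P D (n + k)) (P D k) = c ^+ (q * p.-1) * Phi.
  by rewrite Ex Ey cyc_homog.
have mPhi : Phi \is monic.
  rewrite -(monicMl _ (monic_exp (q * p.-1) mc)) -EPhi.
  rewrite cyc_monic ?P_monic ?addn_gt0 ?n0 // size_P_lt //.
  by rewrite -{1}[k]add0n ltn_add2r.
have [N _ ENxy] := redp_P_sub e n k pp; rewrite -DE in ENxy.
have {}ENxy : redp p c * (redp p x - redp p y)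
    = 'X ^+ N * redp p (P D n) ^+ (D ^ k).
  by rewrite -ENxy Ex Ey -!rmorphB -rmorphM mulrBr.
have xy : redp p x != redp p y.
  apply/eqP => xy; move/eqP: ENxy; rewrite xy subrr mulr0 eq_sym mulf_eq0.
  by rewrite !expf_eq0 polyX_eq0 (negPf (redp_monic_neq0 _ (P_monic D0 n0))) !andbF.
have redPhi : redp p Phi = (redp p x - redp p y) ^+ (q * p.-1).
  by rewrite rmorph_cyc cyc_pchar // pchar_poly pchar_Fp.
have qp0 : (0 < q * p.-1)%N.
  by rewrite muln_gt0 q0 /= -subn1 subn_gt0 prime_gt1.
have rPhi : r %| redp p Phi.
  rewrite redPhi dvdp_exp // -rmorphB (dvdp_trans rE) //; exact: redp_dvd.
have PhiX (F : {poly int}) : F %| Phi -> F %| P D (n + k.+1) - P D k.+1.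
  move=> FPhi; rewrite addnS -[P D (_ + k).+1]/('X * P D (n + k) ^+ D + 1).
  rewrite -[P D k.+1]/('X * P D k ^+ D + 1) opprD addrACA subrr addr0 -mulrBr.
  move: (P D (n + k)) (P D k) EPhi => X Y EXY.
  rewrite dvdp_mull //; have /dvdnP[i ->] := dD.
  rewrite mulnC !exprM subrXX dvdp_mulr // expnSr -/q -cycM EXY.
  by rewrite mulrA dvdp_mull.
have PhiN (F : {poly int}) : F \is monic -> F %| Phi ->
    redp p F %| 'X ^+ (N * (q * p.-1)) * redp p (P D n) ^+ (D ^ k * (q * p.-1)).
  move=> mF /(redp_dvd p mF) /dvdp_trans-> //; rewrite redPhi.
  move: (q * p.-1)%N => s; by rewrite !exprM -exprMn -ENxy dvdp_exp2r // dvdp_mull.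
have reduces F : F \is monic -> irreducible_poly F -> F %| Phi ->
    (forall m, (m %| n)%N -> (0 < m < n)%N ->
       ~~ (F %| P D (m + k.+1) - P D k.+1)) ->
  r %| redp p F.
  move=> mF iF FPhi Fm; apply: rfac (PhiN F mF FPhi) _.
    rewrite size_map_poly_id0 ?(monicP mF) ?rmorph1 ?oner_neq0 //.
    by case: iF => sF _; rewrite neq_ltn sF orbT.
  move=> m mn /[dup] mltn /andP[m0 _]; rewrite DE.
  apply: (@coprimep_redp_P p e k.+1 m n) => //; rewrite -DE; first exact: PhiX.
  exact: Fm.
have [F [mF iF FPhi rF]] : exists F, [/\ F \is monic, irreducible_poly F,
    F %| Phi & r %| redp p F].
  apply: (@monic_irreducible_divisor (fun F => r %| redp p F)) => //.
    by rewrite rmorph1; apply/negP/irreducible_Ndvd1.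
  by move=> A B _ _; rewrite rmorphM irreducible_dvdM // => /orP.
have Fy : ~~ (F %| P D k).
  rewrite Ey irreducible_dvdM // negb_or; apply/andP; split; apply/negP.
    by move=> Fc; have := irreducible_Ndvd1 iF; rewrite {1}(cPhi F) // dvdpp.
  move=> /(redp_dvd p mF) /(dvdp_trans rF); exact/negP.
have Fm m : (m %| n)%N -> (0 < m < n)%N ->
    ~~ (F %| P D (m + k.+1) - P D k.+1).
  move=> mn mltn; apply/negP => /(redp_dvd p mF) /(dvdp_trans rF).
  have [M _ EM] := redp_P_sub e m k.+1 pp; rewrite DE EM.
  have := rm m mn mltn; rewrite !irreducible_dvdM // negb_or => /andP[rX rP].
  rewrite -DE => /orP[] /(irreducible_dvdX irr); exact/negP.
have Phi_root (a : C) : ~~ root (map_poly intr (P D k)) a ->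
    cyc p q (map_poly intr (P D (n + k))).[a] (map_poly intr (P D k)).[a] = 0 ->
  root (map_poly intr Phi) a.
  rewrite horner_map_cyc EPhi Ey rmorphM rootM negb_or => /andP[ca _] /eqP.
  rewrite -rootE rmorphM rmorphXn rootM rootE horner_exp expf_eq0 -rootE.
  by rewrite (negPf ca) andbF.
suff FR : is_Rpre C D k.+1 n (p ^ j.+1) F.
  suff -> : Rpre C D k.+1 n (p ^ j.+1) = F by apply/irreducible_rat_int.
  by apply: xget_unique => // G GR; apply: Rpre_unique GR FR.
split=> // [a|a]; last exact: irreducible_simple_roots.
split=> [Fa|].
  apply/misiurewiczP => //; split.
  - apply/eqP; rewrite horner_map_cyc EPhi -rootE (irreducible_dvdp_root _ iF Fa).
    exact: dvdp_mull.
  - by rewrite (irreducible_dvdp_root _ iF Fa).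
  - by move=> m mn mltn; rewrite (irreducible_dvdp_root _ iF Fa) Fm.
move=> /(misiurewiczP _ _ pp dD D0 n0)[a0 ya ma].
have [F2 [mF2 iF2 F2Phi F2a]] : exists F2 : {poly int}, [/\ F2 \is monic,
    irreducible_poly F2, F2 %| Phi & root (map_poly (intr : int -> C) F2) a].
  apply: (@monic_irreducible_divisor (fun F2 => root (map_poly intr F2) a)) => //.
  - by rewrite rmorph1; apply/negP/root1.
  - by move=> A B _ _; rewrite rmorphM rootM => /orP.
  - exact: Phi_root.
have rF2 : r %| redp p F2.
  apply: reduces => // m mn mltn.
  by rewrite -(irreducible_dvdp_root _ iF2 F2a) ma.
have [H EH] := dvdp_int_monic mF FPhi.
move: (F2Phi); rewrite EH irreducible_dvdM // => /orP[F2F|/(dvdp_int_monic mF2)[G EG]].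
  suff <- : F2 = F by [].
  apply/eqP; rewrite -eqp_monic //; apply: iF F2F.
  by case: iF2 => s2 _; rewrite neq_ltn s2 orbT.
have /(eisenstein_factor pp irr mE rE r2E Exy ry mF mF2) : F * F2 %| Phi.
  by rewrite EH EG mulrA dvdp_mulr.
by rewrite rF rF2.
Qed.

(** * Sums of the Moebius function *)

Lemma moebius_cases u : [\/ moebius u = 0, moebius u = 1 | moebius u = -1].
Proof.
rewrite /moebius; case: ifP => _; last by constructor 1.
by rewrite -signr_odd; case: odd; [constructor 3 | constructor 2].
Qed.

Lemma moebius_sqr_dvd q u : prime q -> (0 < u)%N -> (q ^ 2 %| u)%N -> moebius u = 0.
Proof.
move=> pq u0 q2u; rewrite /moebius; case: allP => // sqf.
have := q2u; rewrite pfactor_dvdn // => lq.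
have /sqf/eqP lq1 : q \in primes u by rewrite -logn_gt0 ltnW.
by rewrite lq1 in lq.
Qed.

Lemma moebius_prime_mul q v :
  prime q -> (0 < v)%N -> ~~ (q %| v)%N -> moebius (q * v) = - moebius v.
Proof.
move=> pq v0 qv; have q0 := prime_gt0 pq.
have qNv : q \notin primes v by rewrite mem_primes pq v0.
have Epr : perm_eq (primes (q * v)) (q :: primes v).
  apply: uniq_perm; rewrite ?primes_uniq //= ?qNv ?primes_uniq // => z.
  by rewrite primesM // inE primes_prime // inE.
rewrite /moebius (perm_all _ Epr) (perm_size Epr) /= lognM // logn_prime // eqxx.
rewrite logn_coprime ?prime_coprime // addn0 eqxx /=.
have -> : all (fun z => logn z (q * v) == 1%N) (primes v)
        = all (fun z => logn z v == 1%N) (primes v).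
  apply: eq_in_all => z zv; rewrite lognM // logn_prime //.
  by case: (eqVneq z q) zv => // ->; rewrite (negPf qNv).
by case: ifP => _; rewrite ?oppr0 // exprS mulN1r.
Qed.

(** Let [q] be a prime factor of [s].  The terms divisible by [q ^ 2] vanish and
[v |-> q * v] pairs the others so that the terms of each pair cancel. *)
Lemma sum_moebius s : (1 < s)%N -> \sum_(u <- divisors s) moebius u = 0.
Proof.
move=> s1; have s0 := ltnW s1; have pq := pdiv_prime s1; set q := pdiv s in pq.
have qs : (q %| s)%N := pdiv_dvd s; have q0 := prime_gt0 pq.
rewrite (bigID (fun u => q %| u)%N) /=.
rewrite (bigID (fun u => q ^ 2 %| u)%N) /= big1_seq ?add0r; last first.
  move=> u /andP[/andP[_ q2u]]; rewrite -dvdn_divisors // => us.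
  by apply: moebius_sqr_dvd q2u => //; apply: dvdn_gt0 us.
have E : perm_eq [seq u <- divisors s | (q %| u)%N && ~~ (q ^ 2 %| u)%N]
    [seq (q * v)%N | v <- divisors s & ~~ (q %| v)%N].
  apply: uniq_perm; first by rewrite filter_uniq ?divisors_uniq.
    rewrite map_inj_uniq ?filter_uniq ?divisors_uniq // => a b /eqP.
    by rewrite eqn_pmul2l // => /eqP.
  move=> u; rewrite mem_filter -dvdn_divisors //.
  apply/andP/mapP => [[/andP[/dvdnP[v ->]]]|[v]].
    rewrite mulnC -mulnn dvdn_pmul2l // => qv qvs.
    exists v => //; rewrite mem_filter qv -dvdn_divisors //=.
    exact: dvdn_trans (dvdn_mull _ (dvdnn v)) qvs.
  rewrite mem_filter -dvdn_divisors // => /andP[qv vs] ->.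
  rewrite dvdn_mulr // -mulnn dvdn_pmul2l // qv; split=> //.
  by rewrite Gauss_dvd ?qs // prime_coprime.
rewrite -big_filter (perm_big _ E) big_map big_filter.
rewrite -big_split /= big1_seq // => v /andP[qv].
rewrite -dvdn_divisors // => vs.
by rewrite moebius_prime_mul ?addNr // (dvdn_gt0 s0 vs).
Qed.

Lemma sum_moebius_codivisors n t : (0 < n)%N -> (t %| n)%N ->
  \sum_(m <- divisors n | (t %| m)%N) moebius (n %/ m) = (t == n)%:R.
Proof.
move=> n0 tn; have t0 := dvdn_gt0 n0 tn; have [s En] := dvdnP tn.
have s0 : (0 < s)%N by move: n0; rewrite En muln_gt0 => /andP[].
have E : perm_eq [seq m <- divisors n | (t %| m)%N]
                 [seq (n %/ u)%N | u <- divisors s].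
  apply: uniq_perm; first by rewrite filter_uniq ?divisors_uniq.
    rewrite map_inj_in_uniq ?divisors_uniq // => a b.
    rewrite -!dvdn_divisors // => as_ bs /(congr1 (divn n)).
    by rewrite !divnA ?mulKn // En dvdn_mulr.
  move=> m; rewrite mem_filter -dvdn_divisors //.
  apply/andP/mapP => [[/dvdnP[v Em] mn]|[u]].
    have [w Ew] := dvdnP mn; exists w; rewrite -?dvdn_divisors //.
      move/eqP: Ew; rewrite En Em mulnA eqn_pmul2r // => /eqP ->.
      exact: dvdn_mulr.
    rewrite Ew mulKn //; move: n0; rewrite Ew muln_gt0 => /andP[] //.
  rewrite -dvdn_divisors // => us ->; split.
    by rewrite En -divn_mulAC // dvdn_mull.
  by rewrite dvdn_div // En dvdn_mulr.
rewrite -big_filter (perm_big _ E) big_map.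
have -> : (t == n) = (s == 1%N).
  by rewrite En -{1}[t]mul1n eqn_pmul2r // eq_sym.
have nd u : u \in divisors s -> (n %/ (n %/ u) = u)%N.
  by rewrite -dvdn_divisors // => us; rewrite divnA ?mulKn // En dvdn_mulr.
rewrite (eq_big_seq moebius) => [|u us]; last by rewrite nd.
case: eqP => [->|/eqP s1]; first by rewrite big_seq1.
by rewrite sum_moebius // ltn_neqAle eq_sym s1.
Qed.

(** * The polynomials Rper modulo p *)

Lemma is_Rper_mul D n Q : (0 < D)%N -> (0 < n)%N -> is_Rper D n Q ->
  Q * \prod_(m <- divisors n | moebius (n %/ m) == -1) P D m
  = \prod_(m <- divisors n | moebius (n %/ m) == 1) P D m.
Proof.
move=> D0 n0 HQ; apply/eqP; rewrite -tofrac_eq rmorphM !rmorph_prod /= HQ; apply/eqP.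
rewrite [X in _ * X]big_mkcond [RHS]big_mkcond -big_split /=.
apply: eq_big_seq => m; rewrite -dvdn_divisors // => mn.
have Pm0 : tofrac (P D m) != 0.
  by rewrite tofrac_eq0 monic_neq0 ?P_monic // (dvdn_gt0 n0 mn).
by case: (moebius_cases (n %/ m)) => ->; rewrite ?expr0z ?expr1z ?exprN1 /= ?mulr1 ?mulVf.
Qed.

(** As [D] vanishes modulo [p], the derivative of [P_n = 'X * P_(n-1)^D + 1] is
[P_(n-1)^D], which is prime to [P_n]. *)
Lemma redp_P_squarefree p e n (r : {poly 'F_p}) : prime p -> (0 < e)%N ->
  irreducible_poly r -> (0 < n)%N -> ~~ (r ^+ 2 %| redp p (P (p ^ e) n)).
Proof.
move=> pp e0 irr; case: n => // n _; apply/negP => /dvdpP[s Es].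
have ES : redp p (P (p ^ e) n.+1) = 'X * redp p (P (p ^ e) n) ^+ (p ^ e) + 1.
  by rewrite !redp_P.
have r1 : r %| redp p (P (p ^ e) n.+1) by rewrite Es expr2 mulrA dvdp_mull.
have : r %| (redp p (P (p ^ e) n.+1))^`().
  rewrite Es expr2 mulrA derivM; apply: dvdp_add; first exact: dvdp_mull.
  by rewrite mulrAC dvdp_mull.
rewrite {1}ES derivD derivM derivX mul1r deriv_exp derivC addr0.
have pA : p \in [pchar {poly 'F_p}] by rewrite pchar_poly pchar_Fp.
have De0 (f : {poly 'F_p}) : f *+ (p ^ e) = 0.
  by rewrite -(prednK e0) expnS mulrnA (mulrn_pchar pA) mul0rn.
rewrite De0 mulr0 addr0 => rP; apply/negP: r1.
rewrite ES dvdp_addr ?dvdp_mull //; exact: irreducible_Ndvd1.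
Qed.

Lemma prod_squarefree_valuation (A : fieldType) (I : eqType) (s : seq I)
    (T : pred I) (f : I -> {poly A}) (r : {poly A}) :
    irreducible_poly r -> {in s, forall i, ~~ (r ^+ 2 %| f i)} ->
  exists2 g, ~~ (r %| g) &
    \prod_(i <- s | T i) f i = r ^+ count (fun i => T i && (r %| f i)) s * g.
Proof.
move=> irr; elim: s => [|i s IHs] sqf.
  by exists 1; rewrite ?irreducible_Ndvd1 // big_nil mul1r.
have [|g rg Eg] := IHs; first by move=> k ks; rewrite sqf // inE ks orbT.
rewrite big_cons Eg /=; case: (T i) => /=; last by exists g.
have [/dvdpP[h Eh]|rfi] := boolP (r %| f i); last first.
  by exists (f i * g); rewrite ?irreducible_dvdM ?negb_or ?rfi // add0n mulrCA.
exists (h * g); last by rewrite exprD expr1 Eh; ring.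
rewrite irreducible_dvdM // negb_or rg andbT.
have := sqf i; rewrite inE eqxx => /(_ isT); apply: contra => rh.
by rewrite Eh expr2 dvdp_mul2r ?irredp_neq0.
Qed.

Lemma valuation_unique (A : idomainType) (r g h : {poly A}) a b :
    irreducible_poly r -> ~~ (r %| g) -> ~~ (r %| h) ->
  r ^+ a * g = r ^+ b * h -> a = b.
Proof.
move=> irr rg rh; wlog ab : a b g h rg rh / (a <= b)%N => [hw|].
  case: (leqP a b) => [ab|/ltnW ab] E; first exact: hw rg rh ab E.
  exact/esym/(hw _ _ _ _ rh rg ab (esym E)).
have ra0 : r ^+ a != 0 by rewrite expf_neq0 ?irredp_neq0.
rewrite -(subnKC ab) exprD -mulrA => /(mulfI ra0) E; move: rg; rewrite E.
case: (b - a)%N => [|c]; first by rewrite addn0.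
by rewrite exprS -mulrA dvdp_mulr.
Qed.

Lemma count_signs (I : Type) (s : seq I) (f : I -> int) (T : pred I) :
    (forall i, [\/ f i = 0, f i = 1 | f i = -1]) ->
  (count (fun i => (f i == 1) && T i) s)%:Z
  = (count (fun i => (f i == -1) && T i) s)%:Z + \sum_(i <- s | T i) f i.
Proof.
move=> f01; elim: s => [|i s IHs]; first by rewrite big_nil.
rewrite big_cons /= !PoszD IHs; case: (f01 i) => ->; case: (T i) => /=; lia.
Qed.

(** By [P_dvd_shift] the indices [m] such that [r] divides [P D m] modulo [p] are
the multiples of the smallest positive one, [t].  Comparing the multiplicities
of [r] in the two sides of [is_Rper_mul], the sum of [moebius (n %/ m)] over
the multiples [m] of [t] dividing [n] is [1], so [t = n]. *)
Lemma dvd_redp_P_Rper p e n (r : {poly 'F_p}) :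
    prime p -> (0 < e)%N -> (0 < n)%N -> irreducible_poly r ->
    is_Rper (p ^ e) n (Rper (p ^ e) n) -> r = redp p (Rper (p ^ e) n) ->
  forall m, (r %| redp p (P (p ^ e) m)) = (n %| m)%N.
Proof.
move=> pp e0 n0 irr HQ Er; set D := (p ^ e)%N in HQ Er *.
have D0 : (0 < D)%N by rewrite expn_gt0 prime_gt0.
have sqf : {in divisors n, forall m, ~~ (r ^+ 2 %| redp p (P D m))}.
  move=> m; rewrite -dvdn_divisors // => /(dvdn_gt0 n0).
  exact: redp_P_squarefree.
have := congr1 (redp p) (is_Rper_mul D0 n0 HQ); rewrite rmorphM !rmorph_prod /= -Er.
have [gm rgm ->] := prod_squarefree_valuation
  (fun m => moebius (n %/ m) == -1) irr sqf.
have [gp rgp ->] := prod_squarefree_valuation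
  (fun m => moebius (n %/ m) == 1) irr sqf.
rewrite mulrA -exprS => /(valuation_unique irr rgm rgp) Ecount.
have := @count_signs _ (divisors n) (fun m => moebius (n %/ m))
  (fun m => r %| redp p (P D m)) (fun m => moebius_cases _).
rewrite -Ecount intS addrC => /addrI Esum.
have [t0 [t0_gt0 t0n rt0]] : exists t, [/\ (0 < t)%N, (t %| n)%N & r %| redp p (P D t)].
  have : has (fun m => (moebius (n %/ m) == 1) && (r %| redp p (P D m)))
    (divisors n) by rewrite has_count -Ecount.
  move=> /hasP[t]; rewrite -dvdn_divisors // => tn /andP[_ rt].
  by exists t; rewrite (dvdn_gt0 n0 tn).
have ex : exists t, (0 < t)%N && (r %| redp p (P D t)).
  by exists t0; rewrite t0_gt0.
case: (ex_minnP ex) => t /andP[t_gt0 rt] tmin.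
have shift m : (r %| redp p (P D (m + t))) = (r %| redp p (P D m)).
  rewrite -[P D (m + t)](subrK (P D m)) rmorphD dvdp_addr //.
  by rewrite (dvdp_trans rt) // redp_dvd ?P_monic ?P_dvd_shift.
have tP m : (r %| redp p (P D m)) = (t %| m)%N.
  rewrite {1}(divn_eq m t) addnC; have -> :
      (r %| redp p (P D (m %% t + m %/ t * t))) = (r %| redp p (P D (m %% t))).
    by elim: (m %/ t)%N => [|c IHc]; rewrite ?addn0 // mulSnr addnA shift.
  apply/idP/idP => [rm|/eqP ->]; last by rewrite rmorph0 dvdp0.
  have := tmin (m %% t)%N; rewrite rm andbT /dvdn.
  by case: (m %% t)%N (ltn_pmod m t_gt0) => // c ct /(_ isT); rewrite leqNgt ct.
suff -> : n = t by [].
have tn : (t %| n)%N by rewrite (dvdn_trans _ t0n) // -tP.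
move: Esum; rewrite (eq_bigl (fun m => (t %| m)%N)) => [|m]; last exact: tP.
by rewrite sum_moebius_codivisors //; case: eqP.
Qed.

(** [P D n] divides the product of [Rper D n] and of polynomials [P D m] with
[m] a proper divisor of [n], because [moebius 1 = 1]. *)
Lemma dvdp_of_coprime_proper p e n (r : {poly 'F_p}) N M (F : {poly 'F_p}) :
    prime p -> (0 < e)%N -> (1 < n)%N -> irreducible_poly r ->
    is_Rper (p ^ e) n (Rper (p ^ e) n) -> r = redp p (Rper (p ^ e) n) ->
    size F != 1%N ->
    F %| 'X ^+ N * redp p (P (p ^ e) n) ^+ M ->
    (forall m, (m %| n)%N -> (0 < m < n)%N ->
       coprimep F ('X * redp p (P (p ^ e) m))) ->
  r %| F.
Proof.
move=> pp e0 n1 irr HQ Er sF FXP cop; set D := (p ^ e)%N in HQ Er FXP cop.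
have n0 := ltnW n1.
have D0 : (0 < D)%N by rewrite expn_gt0 prime_gt0.
apply: contraNT sF; rewrite -irreducible_poly_coprime // coprimep_sym => Fr.
have FX : coprimep F 'X.
  by have := cop 1%N (dvd1n n); rewrite n1 coprimepMr => /(_ isT) /andP[].
have FP : coprimep F (redp p (P D n)).
  have Pn : redp p (P D n) %| r * redp p
      (\prod_(m <- divisors n | moebius (n %/ m) == -1) P D m).
    rewrite Er -rmorphM (is_Rper_mul D0 n0 HQ) redp_dvd ?P_monic //.
    rewrite (big_rem n) ?divisors_id //= divnn n0 /= dvdp_mulr //.
  apply: coprimep_dvdl Pn _; rewrite coprimepMr Fr rmorph_prod /=.
  rewrite big_seq_cond; elim/big_rec: _ => [|m g]; first exact: coprimep1.
  rewrite -dvdn_divisors // => /andP[mn mu] Fg; rewrite coprimepMr Fg andbT.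
  have := cop m mn; rewrite (dvdn_gt0 n0 mn) ltn_neqAle (dvdn_leq n0 mn) andbT.
  case: (eqVneq m n) mu => [->|_ _ /(_ isT)]; first by rewrite divnn n0.
  by rewrite coprimepMr => /andP[].
rewrite -coprimepp; apply: coprimep_dvdl FXP _.
by rewrite coprimepMr !coprimep_expr.
Qed.

(** * The theorem, for period one and for larger periods *)

Lemma monic_dvdp_const (F : {poly int}) n :
  F \is monic -> (0 < n)%N -> F %| n%:R -> F = 1.
Proof.
move=> mF n0 Fn; have n0' : (n%:R : {poly int}) != 0.
  by rewrite -polyC_natr polyC_eq0 pnatr_eq0 -lt0n.
have := dvdp_leq n0' Fn; rewrite -polyC_natr => /leq_trans/(_ (size_polyC_leq1 _)).
by move/size1_polyC => E; move: mF; rewrite E monicE lead_coefC => /eqP ->.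
Qed.

(** As [0] is a critical point of [f^n], where [f] is the unicritical map,
[f^n z] equals [f^n 0 = P D n] up to a multiple of [z ^+ 2]; apply this to
[z = P D (l * n)], which is a multiple of [P D n]. *)
Lemma P_mul_quotient D n l : (1 < D)%N -> (0 < n)%N ->
  exists2 y, P D (l.+1 * n) = P D n * y & P D n %| y - 1.
Proof.
move=> D1 n0.
have sq i z : (0 < i)%N ->
    exists u, iter i (unicritical D 'X) z = P D i + z ^+ 2 * u :> {poly int}.
  case: i => // i _; have [u Eu] := iter_unicritical_sub D i 'X (unicritical D 'X z) 1.
  exists ('X * z ^+ D.-2 * u); rewrite iterSr; move/eqP: Eu.
  have -> : iter i (unicritical D 'X) 1 = P D i.+1.
    by rewrite /P iterSr /unicritical expr0n eqn0Ngt ltnW // mulr0 add0r.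
  rewrite subr_eq addrC /unicritical addrK => /eqP ->; congr (_ + _).
  by rewrite -{1}(subnKC D1) exprD subn2; ring.
elim: l => [|l [y Ey _]]; first by exists 1; rewrite ?mul1n ?mulr1 // subrr dvdp0.
have [u Eu] := sq n (P D (l.+1 * n)) n0.
exists (1 + P D n * (y ^+ 2 * u)).
  by rewrite mulSn P_addn Eu Ey; ring.
by rewrite addrC addKr dvdp_mulr.
Qed.

Lemma irreducible_X (A : idomainType) : irreducible_poly ('X : {poly A}).
Proof. by rewrite -['X]subr0; apply: irredp_XsubC. Qed.

(** This is the criterion of Eisenstein for [cyc p (p ^ j) (P D k.+1) (P D k)], a
power of ['X] modulo [p] whose value at [0] is [p]. *)
Lemma Rpre1_irreducible (C : numClosedFieldType) p e j D k :
    prime p -> (0 < e)%N -> D = (p ^ e)%N -> (p ^ j.+1 %| D)%N -> (0 < k)%N ->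
  irreducible_poly
    (map_poly (intr : int -> rat) (Rpre C D k.+1 1 (p ^ j.+1))).
Proof.
move=> pp e0 DE dD k0; have irX := irreducible_X 'F_p.
have D0 : (0 < D)%N by rewrite DE expn_gt0 prime_gt0.
have P1 : P D 1 = 1 by rewrite /P /= /unicritical expr0n eqn0Ngt D0 mulr0 add0r.
apply: (@Rpre_irreducible C p e j D k 1 'X 'X 1 (P D (1 + k)) (P D k)) => //.
- by move=> m _; case: m => [|[]].
- move=> N M F sF; rewrite P1 rmorph1 expr1n mulr1 => FX _.
  apply: contraNT sF; rewrite -irreducible_poly_coprime // coprimep_sym => cFX.
  by rewrite -coprimepp; apply: coprimep_dvdl FX _; apply: coprimep_expr.
- exact: monicX.
- by rewrite map_polyX.
- rewrite map_polyX; apply/negP => /dvdp_leq; rewrite polyX_eq0 => /(_ isT).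
  by rewrite size_polyX size_polyXn.
- exact: monic1.
- by rewrite mul1r.
- by rewrite mul1r.
- case: k k0 => // k _; rewrite add1n -[P D k.+2]/('X * P D k.+1 ^+ D + 1).
  rewrite -[P D k.+1 in X in _ - X]/('X * P D k ^+ D + 1) opprD addrACA subrr addr0.
  by rewrite -mulrBr dvdp_mulr.
- case: k k0 => // k _; rewrite -[P D k.+1]/('X * P D k ^+ D + 1).
  rewrite rmorphD rmorphM rmorph1 /= map_polyX dvdp_addr ?dvdp_mulr //.
  exact: irreducible_Ndvd1.
- by move=> F mF F1 _; apply: (@monic_dvdp_const F 1).
Qed.

(** If [n] divides [k], then [P D n] divides both [P D (n + k)] and [P D k]; the
quotients are congruent to [1] modulo [P D n], so the value of the cyclotomic
form on them is congruent to [p]. *)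
Lemma Rpre_gt1_irreducible (C : numClosedFieldType) p e j D k n :
    prime p -> (0 < e)%N -> D = (p ^ e)%N -> (p ^ j.+1 %| D)%N -> (0 < k)%N ->
    (1 < n)%N -> irreducible_poly (redp p (Rper D n)) ->
  irreducible_poly
    (map_poly (intr : int -> rat) (Rpre C D k.+1 n (p ^ j.+1))).
Proof.
move=> pp e0 DE dD k0 n1; have n0 := ltnW n1.
have D1 : (1 < D)%N by rewrite DE -{1}(expn0 p) ltn_exp2l ?prime_gt1.
subst D; set D := (p ^ e)%N in dD D1 *; move=> irr.
have HQ : is_Rper D n (Rper D n).
  rewrite /Rper; case: xgetP => //= noQ.
  by have := irredp_neq0 irr; rewrite /Rper xgetPN // rmorph0 eqxx.
set r := redp p (Rper D n) in irr.
have rP m : (r %| redp p (P D m)) = (n %| m)%N.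
  exact: dvd_redp_P_Rper pp e0 n0 irr HQ (erefl _) m.
have rX : ~~ (r %| 'X).
  apply/negP => rX; have := rP n; rewrite dvdnn -{1}(prednK n0).
  rewrite -[P D _.+1]/('X * P D n.-1 ^+ D + 1) rmorphD rmorphM rmorph1 /= map_polyX.
  by rewrite dvdp_addr ?dvdp_mulr // (negPf (irreducible_Ndvd1 irr)).
have rm m : (m %| n)%N -> (0 < m < n)%N -> ~~ (r %| 'X * redp p (P D m)).
  move=> mn /andP[m0 ltmn]; rewrite irreducible_dvdM // negb_or rX rP.
  by apply/negP => /(dvdn_leq m0); rewrite leqNgt ltmn.
have rfac N M (F : {poly 'F_p}) : size F != 1%N ->
    F %| 'X ^+ N * redp p (P D n) ^+ M ->
    (forall m, (m %| n)%N -> (0 < m < n)%N -> coprimep F ('X * redp p (P D m))) ->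
  r %| F.
  exact: dvdp_of_coprime_proper pp e0 n1 irr HQ (erefl _).
have mP : P D n \is monic := P_monic (ltnW D1) n0.
have rPn : r %| redp p (P D n) by rewrite rP.
have r2P : ~~ (r ^+ 2 %| redp p (P D n)) by exact: redp_P_squarefree.
have [nk|nk] := boolP (n %| k)%N; last first.
  apply: (@Rpre_irreducible C p e j D k n r (P D n) 1 (P D (n + k)) (P D k));
    rewrite ?mul1r ?monic1 ?rP //.
  - by rewrite addnC P_dvd_shift.
  - by move=> F mF F1 _; apply: (@monic_dvdp_const F 1).
have [[|l] Ek] := dvdnP nk; first by rewrite Ek in k0.
have [y Ey y1] := P_mul_quotient l D1 n0; rewrite -Ek in Ey.
have [x Ex x1] := P_mul_quotient l.+1 D1 n0; rewrite mulSn -Ek in Ex.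
have xy : P D n %| x - y.
  have -> : x - y = (x - 1) - (y - 1) by ring.
  exact: dvdp_sub.
apply: (@Rpre_irreducible C p e j D k n r (P D n) (P D n) x y) => //.
- rewrite -(subrK 1 y) rmorphD rmorph1 dvdp_addr ?irreducible_Ndvd1 //.
  by rewrite (dvdp_trans rPn) // redp_dvd.
- move=> F mF FP FPhi; apply: (@monic_dvdp_const F p) => //; first exact: prime_gt0.
  have [u Eu] := cyc_congr p (p ^ j) x y; rewrite cyc_diag in Eu.
  have Fy : F %| y ^+ (p ^ j * p.-1) - 1.
    by rewrite -[X in _ - X](expr1n _ (p ^ j * p.-1)) subrXX dvdp_mulr // (dvdp_trans FP).
  have -> : p%:R = cyc p (p ^ j) x y - (x - y) * u
      - p%:R * (y ^+ (p ^ j * p.-1) - 1) by rewrite Eu; ring.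
  apply: dvdp_sub; last exact: dvdp_mull.
  by apply: dvdp_sub => //; rewrite dvdp_mulr // (dvdp_trans FP).
Qed.

Theorem theorem18 (R : realType) (p e D : nat) (p_prime : prime p)
    (e_gt0 : (0 < e)%N) (DE : D = (p ^ e)%N) :
  (forall k d : nat, (2 <= k)%N -> (2 <= d)%N -> (d %| D)%N ->
     irreducible_poly
       (map_poly (intr : int -> rat) (Rpre (complex R) D k 1 d)))
  /\
  (forall n : nat, (2 <= n)%N ->
     irreducible_poly (map_poly (intr : int -> 'F_p) (Rper D n)) ->
     forall k d : nat, (2 <= k)%N -> (2 <= d)%N -> (d %| D)%N ->
     irreducible_poly
       (map_poly (intr : int -> rat) (Rpre (complex R) D k n d))).
Proof.
have dP d : (2 <= d)%N -> (d %| D)%N -> exists j, d = (p ^ j.+1)%N.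
  move=> d2; rewrite DE => /(dvdn_pfactor _ _ p_prime)[[|j] _ Ed].
    by rewrite Ed in d2.
  by exists j.
split=> [[|k] d k2 d2 dD|n n2 irr [|k] d k2 d2 dD] //.
  by have [j Ed] := dP d d2 dD; subst d; apply: Rpre1_irreducible p_prime e_gt0 DE dD _.
by have [j Ed] := dP d d2 dD; subst d; apply: Rpre_gt1_irreducible p_prime e_gt0 DE dD _ _ _.
Qed.
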